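(* Let $n\geq 9$ be an integer. There exist $n$-dimensional spherical orbifolds $M_1$ and $M_2$ which are eigenvalue equivalent and whose volumes satisfy $\mathrm{vol}(M_2)=3\cdot \mathrm{vol}(M_1)$.
   Context: $S^n$ is the unit sphere in $\mathbb{R}^{n+1}$ with its Riemannian metric of constant sectional curvature one; its isometry group is $\mathrm{O}(n+1)$. A spherical orbifold of dimension $n$ is a quotient $S^n/\Gamma$ with $\Gamma$ a finite subgroup of $\mathrm{O}(n+1)$ (not necessarily acting freely), with the induced metric; its volume is $\mathrm{vol}(S^n/\Gamma)=\mathrm{vol}(S^n)/|\Gamma|$. The Laplace-Beltrami operator of $S^n/\Gamma$ is the Laplace-Beltrami operator of $S^n$ acting on $\Gamma$-invariant functions. Two closed Riemannian orbifolds are eigenvalue equivalent if they have the same set of eigenvalues of the Laplace-Beltrami operator, multiplicities being ignored. *)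

(* Defs.v *)
From HB Require Import structures.
From mathcomp Require Import all_boot all_order all_algebra finmap.
From mathcomp Require Import all_classical all_reals all_analysis.

Set Implicit Arguments.
Unset Strict Implicit.
Unset Printing Implicit Defensive.

Import Order.TTheory GRing.Theory Num.Theory.
Import numFieldTopology.Exports numFieldNormedType.Exports.

Local Open Scope classical_set_scope.
Local Open Scope ring_scope.

(* R^(n+1) is 'rV[R]_n.+1.  Its library norm `|x| is the sup norm, hence the
   separate Euclidean norm. *)
Definition enorm (R : realType) (m : nat) (x : 'rV[R]_m) : R :=
  Num.sqrt (\sum_i x 0 i ^+ 2).

Definition sphere (R : realType) (n : nat) : set 'rV[R]_n.+1 :=
  [set x | enorm x = 1].

Definition radial_proj (R : realType) (n : nat) (x : 'rV[R]_n.+1)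
  : 'rV[R]_n.+1 := (enorm x)^-1 *: x.

Definition partial (R : realType) (n : nat) (i : 'I_n.+1)
  (F : 'rV[R]_n.+1 -> R) : 'rV[R]_n.+1 -> R :=
  fun x => 'D_(delta_mx 0 i) F x.

Definition iter_partial (R : realType) (n : nat) (s : seq 'I_n.+1)
  (F : 'rV[R]_n.+1 -> R) : 'rV[R]_n.+1 -> R :=
  foldr (@partial R n) F s.

(* C^oo on the open set U: the iterated partial derivatives of every order
   exist and are continuous. *)
Definition smooth_on (R : realType) (n : nat) (U : set 'rV[R]_n.+1)
  (F : 'rV[R]_n.+1 -> R) : Prop :=
  forall (s : seq 'I_n.+1) (x : 'rV[R]_n.+1), U x ->
    {for x, continuous (iter_partial s F)} /\
    forall i : 'I_n.+1, derivable (iter_partial s F) x (delta_mx 0 i).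

(* A function on S^n is represented by a function f on R^(n+1) of which only
   the values on the sphere matter: f is always precomposed with the radial
   projection R^(n+1) \ {0} -> S^n, a smooth retraction, so that f is smooth on
   S^n iff f \o radial_proj is smooth off the origin. *)
Definition smooth_on_sphere (R : realType) (n : nat) (f : 'rV[R]_n.+1 -> R)
  : Prop := smooth_on [set x | x != 0] (f \o @radial_proj R n).

(* Gradient and divergence for the metric induced by R^(n+1).  At a point x of
   S^n the derivative of a radially constant extension vanishes in the normal
   direction x, so its Euclidean gradient is the tangential gradient of f, and
   its Euclidean divergence is the trace of the derivative of X over the
   tangent space, which is div X for a tangent field X. *)
Definition sphere_grad (R : realType) (n : nat) (f : 'rV[R]_n.+1 -> R)
  (x : 'rV[R]_n.+1) : 'rV[R]_n.+1 :=
  \row_i partial i (f \o @radial_proj R n) x.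

Definition sphere_div (R : realType) (n : nat)
  (X : 'rV[R]_n.+1 -> 'rV[R]_n.+1) (x : 'rV[R]_n.+1) : R :=
  \sum_i partial i (fun y => X (radial_proj y) 0 i) x.

Definition laplace_beltrami (R : realType) (n : nat) (f : 'rV[R]_n.+1 -> R)
  (x : 'rV[R]_n.+1) : R := - sphere_div (sphere_grad f) x.

(* The metric of S^(k+1) in polar coordinates around a point is
   dt^2 + sin(t)^2 g_{S^k} with 0 < t < pi. *)
Fixpoint sphere_volume (R : realType) (n : nat) : R :=
  if n is k.+1 then
    (\int[@lebesgue_measure R]_(t in `[0, pi]) (sin t ^+ k)) *
    sphere_volume R k
  else 2.

(* Finite subgroups of O(m), acting on row vectors by x |-> x *m A. *)
Definition orthogonal_group (R : realType) (m : nat) (G : {fset 'M[R]_m})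
  : Prop :=
  [/\ {in G, forall A, A *m A^T = 1%:M},
      1%:M \in G,
      {in G &, forall A B, A *m B \in G} &
      {in G, forall A, invmx A \in G}].

(* S^n / Gamma, given by the group Gamma. *)
Record spherical_orbifold (R : realType) (n : nat) := SphericalOrbifold {
  orbifold_group : {fset 'M[R]_n.+1};
  orbifold_groupP : orthogonal_group orbifold_group }.

Definition orbifold_volume (R : realType) (n : nat)
  (M : spherical_orbifold R n) : R :=
  sphere_volume R n / (#|` orbifold_group M|)%:R.

Definition invariant (R : realType) (n : nat) (M : spherical_orbifold R n)
  (f : 'rV[R]_n.+1 -> R) : Prop :=
  forall A x, A \in orbifold_group M -> sphere x -> f (x *m A) = f x.

Definition is_eigenvalue (R : realType) (n : nat)
  (M : spherical_orbifold R n) (lambda : R) : Prop :=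
  exists f : 'rV[R]_n.+1 -> R,
    [/\ smooth_on_sphere f,
        invariant M f,
        exists2 x, sphere x & f x != 0 &
        forall x, sphere x -> laplace_beltrami f x = lambda * f x].

Definition eigenvalue_equivalent (R : realType) (n : nat)
  (M1 M2 : spherical_orbifold R n) : Prop :=
  [set lambda | is_eigenvalue M1 lambda] =
  [set lambda | is_eigenvalue M2 lambda].

(* Main.v *)
Require Import Defs.
From mathcomp Require Import all_boot all_order all_algebra.
From mathcomp Require Import all_fingroup cyclic finmap.
From mathcomp Require Import all_classical all_reals all_analysis.
From mathcomp Require Import ring lra.

Set Implicit Arguments.
Unset Strict Implicit.
Unset Printing Implicit Defensive.

Import Order.TTheory GRing.Theory Num.Theory.
Import numFieldTopology.Exports numFieldNormedType.Exports.

Local Open Scope classical_set_scope.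
Local Open Scope ring_scope.

(** The volume of a spherical orbifold only sees the order of its group, so it
    is enough to find two groups, of orders 1 and 3, whose quotients have the
    same set of eigenvalues.  The point is that any finite group fixing a point
    [p] of the sphere has a quotient with all the eigenvalues of the full
    sphere: multiplicities drop, but no eigenvalue disappears.  Since
    multiplicities are ignored, the trivial group and the group generated by a
    cyclic permutation of three coordinates, both of which fix every other
    coordinate vector, give the required pair.

    To see that no eigenvalue disappears, let [f] be an eigenfunction on the
    sphere, with [f x0 != 0].  Choose an orthogonal [B] with [p *m B = x0]
    ([orthogonal_transitive], a reflection), so that [f] composed with [B] does
    not vanish at [p], and average it over the group [G]:
    [g x = \sum_(A in G) f (x *m A *m B)].  Then [g] is invariant, and because
    [G] fixes [p] every term of [g p] equals [f x0]; hence [g] is not zero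
    ([is_eigenvalue_fixed_point]).

    What remains is analytic: sums of rotated copies of [f] are smooth and are
    again eigenfunctions ([laplace_beltrami_sum_rotations]).  On the sphere the
    Laplace-Beltrami operator of [f] is minus the Euclidean Laplacian of the
    radially constant extension of [f] ([laplace_beltramiE]), and the Euclidean
    Laplacian commutes with orthogonal changes of variables
    ([euclid_laplacian_rotated_sum]).  Smoothness being given through iterated
    partial derivatives, the chain rule for these changes of variables rests on
    the linearity of [v |-> 'D_v F x] for functions with continuous partial
    derivatives ([smooth_on_is_derive]), a consequence of the mean value
    theorem. *)

(** * Directional derivatives of continuously differentiable functions *)

Section dir.
Context {R : realType} {V : normedModType R}.
Implicit Types (F : V -> R) (x u v w : V).

Lemma is_derive_line F x v (s d : R) :
  is_derive (s *: v + x) v F d -> is_derive s (1 : R) (fun t => F (t *: v + x)) d.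
Proof.
move=> [dF <-]; split.
  move: dF; rewrite /derivable.
  set g1 := fun h => h^-1 *: _; set g2 := fun h => h^-1 *: _.
  suff -> : g1 = g2 by [].
  by rewrite funeqE /g1 /g2 => h /=; rewrite [_%:A]mulr1 scalerDl addrA.
rewrite /derive; set g1 := fun h => h^-1 *: _; set g2 := fun h => h^-1 *: _.
suff -> : g1 = g2 by [].
by rewrite funeqE /g1 /g2 => h /=; rewrite [_%:A]mulr1 scalerDl addrA.
Qed.

Lemma is_derive_of_line F x v (d : R) :
  is_derive (0 : R) (1 : R) (fun t => F (t *: v + x)) d -> is_derive x v F d.
Proof.
move=> [dF <-]; split; first exact/derivable1P.
rewrite /derive; set g1 := fun h => h^-1 *: _; set g2 := fun h => h^-1 *: _.
suff -> : g1 = g2 by [].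
by rewrite funeqE /g1 /g2 => h /=; rewrite addr0 [_%:A]mulr1 scale0r add0r.
Qed.

Lemma is_derive_scale_dir F x v (c d : R) :
  is_derive x v F d -> is_derive x (c *: v) F (c * d).
Proof.
move=> dF; apply: is_derive_of_line.
have -> : (fun t : R => F (t *: (c *: v) + x)) =
    (fun t => F (t *: v + x)) \o ( *:%R c).
  by apply/funext => t /=; rewrite scalerA [t * c]mulrC.
have dF' : is_derive (c *: (0:R)) (1:R) (fun t => F (t *: v + x)) d.
  by apply: is_derive_line; rewrite scaler0 scale0r add0r.
have dc : is_derive (0:R) (1:R) ( *:%R c : R -> R) c.
  have -> : ( *:%R c : R -> R) = c \*: (@id R) by [].
  by apply: is_derive_eq; rewrite [_ *: _]mulr1.
by apply: is_derive_eq; exact: mulrC.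
Qed.

(** Going from [x] to [x + h (u + w)] through [x + h w], the first leg gives the
    derivative along [w]; on the second leg the mean value theorem gives [h]
    times a derivative along [u] at a point near [x], which tends to the one at
    [x] by continuity.  Since [w] is differentiated at [x] only, coordinates can
    be added one by one. *)
Lemma is_derive_add_dir F x u w (d : R) :
  (\forall y \near x, derivable F y u) -> {for x, continuous ('D_u F)} ->
  is_derive x w F d -> is_derive x (u + w) F ('D_u F x + d).
Proof.
move=> dFu cFu [dFw <-].
suff H : (fun h => h^-1 *: ((F \o shift x) (h *: (u + w)) - F x)) @ (0:R)^' -->
    'D_u F x + 'D_w F x.
  by split; [apply/cvg_ex; eexists; exact: H | exact: cvg_lim H].
(* [q] is the difference quotient of the second leg. *)
pose q h : R := h^-1 *: (F (h *: u + (h *: w + x)) - F (h *: w + x)).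
rewrite [X in X @ _ --> _](_ : _ =
    q + (fun h => h^-1 *: ((F \o shift x) (h *: w) - F x))); last first.
  apply/funext => h; rewrite /q /= !fctE -scalerDr.
  by rewrite [h *: (u + w)]scalerDr addrA subrK addrA.
apply: cvgD; last exact: dFw.
apply/cvgrPdist_le => e e0.
have /nbhs_ballP[r /= r0 Hr] : \forall y \near x,
    derivable F y u /\ `|'D_u F x - 'D_u F y| <= e.
  apply: filterI => //.
  by move/cvgrPdist_le : cFu => /(_ _ e0).
near=> h.
have Hb (t : R) : t \in `[0, 1]%R -> ball x r (t *: (h *: u) + (h *: w + x)).
  rewrite in_itv /= => /andP[t0 t1].
  rewrite -ball_normE /= -normrN opprB addrA addrK.
  have : `|h| * (`|u| + `|w|) < r.
    near: h.
    have : (fun h : R => `|h| * (`|u| + `|w|)) @ (0:R)^' --> (0 : R).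
      rewrite -[X in _ --> X](mul0r (`|u| + `|w|)).
      apply: cvgMr_tmp; rewrite -[X in _ --> X](normr0 R); apply: cvg_norm.
      exact: nbhs_dnbhs.
    by move/cvgrPdist_lt => /(_ _ r0); apply: filterS => h;
      rewrite sub0r normrN ger0_norm // mulr_ge0 // addr_ge0.
  apply: le_lt_trans; rewrite mulrDr (le_trans (ler_normD _ _)) // !normrZ lerD //.
  by rewrite ler_piMl ?mulr_ge0 // ger0_norm.
(* Scaling the direction by [h] keeps the interval [[0, 1]] for both signs of
   [h]. *)
pose g t := F (t *: (h *: u) + (h *: w + x)).
pose g' t : R := h * 'D_u F (t *: (h *: u) + (h *: w + x)).
have dg (t : R) : t \in `[0, 1]%R -> is_derive t (1:R) g (g' t).
  move=> /Hb /Hr[dF _]; apply: is_derive_line; apply: is_derive_scale_dir.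
  exact: derivableP.
have dgo (t : R) : t \in `]0, 1[%R -> is_derive t (1:R) g (g' t).
  by move=> /subset_itv_oo_cc /dg.
have cg : {within `[0, 1], continuous g}.
  by apply: derivable_within_continuous => t /dg [].
have [c c01] := MVT (@ltr01 R) dgo cg.
have -> : g 1 = F (h *: u + (h *: w + x)) by rewrite /g scale1r.
have -> : g 0 = F (h *: w + x) by rewrite /g scale0r add0r.
rewrite subr0 mulr1 => Hg.
have h0 : h != 0 by near: h; exact: nbhs_dnbhs_neq.
rewrite /q Hg /g' [_^-1 *: _]mulKf //.
by have [] := Hr _ (Hb _ (subset_itv_oo_cc c01)).
Unshelve. all: by end_near. Qed.

End dir.

Section sums.
Context {R : realType} {V W : normedModType R} {T : Type}.

Lemma is_derive_big (r : seq T) (h : T -> V -> W) (d : T -> W) (x v : V) :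
  (forall t, is_derive x v (h t) (d t)) ->
  is_derive x v (fun y => \sum_(t <- r) h t y) (\sum_(t <- r) d t).
Proof.
move=> hd; elim: r => [|t r IH].
  rewrite big_nil (_ : (fun y => _) = cst 0); first exact: is_derive_cst.
  by apply/funext => y; rewrite big_nil.
rewrite big_cons (_ : (fun y => _) = h t + (fun y => \sum_(t <- r) h t y)).
  exact: is_deriveD.
by apply/funext => y; rewrite big_cons.
Qed.

Lemma continuous_at_sum (r : seq T) (h : T -> V -> W) (x : V) :
  (forall t, {for x, continuous (h t)}) ->
  {for x, continuous (fun y => \sum_(t <- r) h t y)}.
Proof.
move=> hc; elim: r => [|t r IH].
  rewrite (_ : (fun y => _) = cst 0); first exact: cst_continuous.
  by apply/funext => y; rewrite big_nil.
rewrite (_ : (fun y => _) = h t + (fun y => \sum_(t <- r) h t y)).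
  exact: continuousD.
by apply/funext => y; rewrite big_cons.
Qed.

End sums.

Lemma is_derive_mulmx {R : realType} {n m : nat} (F : 'rV[R]_m.+1 -> R)
    (B : 'M[R]_(n.+1, m.+1)) x v (d : R) :
  is_derive (x *m B) (v *m B) F d -> is_derive x v (fun y => F (y *m B)) d.
Proof.
move=> dF; apply: is_derive_of_line.
have -> : (fun t => F ((t *: v + x) *m B)) = (fun t => F (t *: (v *m B) + x *m B)).
  by apply/funext => t; rewrite mulmxDl scalemxAl.
by apply: is_derive_line; rewrite scale0r add0r.
Qed.

Lemma mulmx_continuous {R : realType} {n m : nat} (B : 'M[R]_(n.+1, m.+1)) :
  continuous (fun x : 'rV[R]_n.+1 => x *m B).
Proof.
move=> x.
have -> : (fun y : 'rV[R]_n.+1 => y *m B) = (fun y => \sum_i y 0 i *: row i B).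
  by apply/funext => y; rewrite mulmx_sum_row.
apply: continuous_at_sum => i; apply: (@cvgZr_tmp _ _ _ (nbhs x)).
exact: (@coord_continuous R 1 n.+1 0 i x).
Qed.

(** * Smooth functions on an open set *)

Lemma near_eq_continuous {T S : topologicalType} (F G : T -> S) (x : T) :
  (\forall y \near x, F y = G y) -> {for x, continuous G} ->
  {for x, continuous F}.
Proof.
move=> FG; rewrite /prop_for /continuous_at (nbhs_singleton FG) => cG.
apply: cvg_trans cG; apply: near_eq_cvg.
by apply: filterS FG => y ->.
Qed.

Section smooth.
Context {R : realType} {n : nat} (U : set 'rV[R]_n.+1) (oU : open U).
Implicit Types (F G : 'rV[R]_n.+1 -> R) (x v : 'rV[R]_n.+1).

Let near_U x : U x -> \forall y \near x, U y.
Proof. by move=> Ux; exact: open_nbhs_nbhs. Qed.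

Lemma smooth_on_continuous F x : smooth_on U F -> U x -> {for x, continuous F}.
Proof. by move=> sF /(sF [::])[]. Qed.

Lemma smooth_on_derivable F x i : smooth_on U F -> U x ->
  derivable F x (delta_mx 0 i).
Proof. by move=> sF /(sF [::])[]. Qed.

Lemma smooth_on_partial F i : smooth_on U F -> smooth_on U (partial i F).
Proof.
by move=> sF s x Ux; have := sF (rcons s i) x Ux;
  rewrite /iter_partial foldr_rcons.
Qed.

Lemma eq_on_partial F G i : (forall x, U x -> F x = G x) ->
  forall x, U x -> partial i F x = partial i G x.
Proof.
move=> FG x Ux; apply: near_eq_derive.
by apply: filterS (near_U Ux).
Qed.

(** Smoothness is the largest class of functions whose members are continuous
    and have partial derivatives in the class.  Exhibiting such a class replaces
    an explicit computation of the iterated partial derivatives; membership of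
    the derivatives is only up to equality on [U] since nothing is controlled
    outside of it. *)
Lemma smooth_on_coind (C : ('rV[R]_n.+1 -> R) -> Prop) :
  (forall G, C G -> forall x, U x ->
     {for x, continuous G} /\ forall i, derivable G x (delta_mx 0 i)) ->
  (forall G i, C G -> exists2 G', C G' & forall x, U x -> partial i G x = G' x) ->
  forall G, C G -> smooth_on U G.
Proof.
move=> C0 C1 G CG s.
have {CG} : exists2 G', C G' & forall x, U x -> iter_partial s G x = G' x.
  elim: s => [|i s [G' CG' GG']] /=; first by exists G.
  have [G'' CG'' GG''] := C1 _ i CG'; exists G'' => // x Ux.
  by rewrite -GG'' //; exact: eq_on_partial.
move=> [G' CG' GG'] x Ux; have [cG' dG'] := C0 _ CG' _ Ux.
have E : \forall y \near x, iter_partial s G y = G' y.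
  by apply: filterS (near_U Ux).
split; first exact: near_eq_continuous E cG'.
move=> i; apply: near_eq_derivable (dG' i).
by apply: (filterS _ E) => y /= ->.
Qed.

(** The coordinates of [v] are added one at a time with [is_derive_add_dir]. *)
Lemma smooth_on_is_derive F x v : smooth_on U F -> U x ->
  is_derive x v F (\sum_i v 0 i * partial i F x).
Proof.
move=> sF Ux; rewrite {1}[v]row_sum_delta.
elim: (index_enum _) => [|i r IH].
  by rewrite !big_nil; exact: is_derive0.
rewrite !big_cons.
have [dD vD] : is_derive x (v 0 i *: delta_mx 0 i) F (v 0 i * partial i F x).
  by apply: is_derive_scale_dir; apply: derivableP; exact: smooth_on_derivable.
rewrite -vD; apply: is_derive_add_dir => //.
  apply: filterS (near_U Ux) => y Uy.
  have [] // : is_derive y (v 0 i *: delta_mx 0 i) F (v 0 i * partial i F y).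
  by apply: is_derive_scale_dir; apply: derivableP; exact: smooth_on_derivable.
have E y : U y -> v 0 i * partial i F y = 'D_(v 0 i *: delta_mx 0 i) F y.
  move=> Uy; apply/esym/derive_val.
  by apply: is_derive_scale_dir; apply: derivableP; exact: smooth_on_derivable.
apply: (@near_eq_continuous _ _ _ (fun y => v 0 i * partial i F y)).
  by apply: (filterS _ (near_U Ux)) => y Uy; rewrite E.
apply: (@cvgMl_tmp _ _ (nbhs x)); apply: smooth_on_continuous Ux.
exact: smooth_on_partial.
Qed.

End smooth.

(** * Linear combinations of rotated functions *)

Definition euclid_laplacian {R : realType} {n : nat} (F : 'rV[R]_n.+1 -> R)
    (x : 'rV[R]_n.+1) : R :=
  \sum_i partial i (partial i F) x.

Section rotated.
Context {R : realType} {n : nat} (U : set 'rV[R]_n.+1) (oU : open U).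
Implicit Types (x v : 'rV[R]_n.+1).

(** Weights and varying functions [F t] make this family of functions closed
    under partial derivatives. *)
Definition rotated_sum {T : finType} (c : T -> R)
    (B : T -> 'M[R]_n.+1) (F : T -> 'rV[R]_n.+1 -> R) x : R :=
  \sum_t c t * F t (x *m B t).

Lemma is_derive_rotated_sum {T : finType} (c : T -> R)
    (B : T -> 'M[R]_n.+1) (F : T -> 'rV[R]_n.+1 -> R) x v :
  (forall t x, U x -> U (x *m B t)) -> (forall t, smooth_on U (F t)) -> U x ->
  is_derive x v (rotated_sum c B F)
    (\sum_t c t * \sum_j (v *m B t) 0 j * partial j (F t) (x *m B t)).
Proof.
move=> UB sF Ux; apply: is_derive_big => t.
apply: is_deriveZ; apply: is_derive_mulmx.
by apply: (smooth_on_is_derive oU) => //; exact: UB.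
Qed.

Lemma partial_rotated_sum {T : finType} (c : T -> R)
    (B : T -> 'M[R]_n.+1) (F : T -> 'rV[R]_n.+1 -> R) x i :
  (forall t x, U x -> U (x *m B t)) -> (forall t, smooth_on U (F t)) -> U x ->
  partial i (rotated_sum c B F) x =
  rotated_sum (fun p : T * 'I_n.+1 => c p.1 * B p.1 i p.2) (fun p => B p.1)
    (fun p => partial p.2 (F p.1)) x.
Proof.
move=> UB sF Ux; rewrite /partial.
have [_ ->] := is_derive_rotated_sum c (delta_mx 0 i) UB sF Ux.
rewrite /rotated_sum.
rewrite -(pair_bigA _ (fun t j => c t * B t i j * partial j (F t) (x *m B t))) /=.
apply: eq_bigr => t _; rewrite mulr_sumr; apply: eq_bigr => j _.
by rewrite -rowE mxE mulrA.
Qed.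

(** The chain rule [partial_rotated_sum] says that the class of all rotated sums
    satisfies the hypotheses of [smooth_on_coind]. *)
Lemma smooth_on_rotated_sum {T : finType} (c : T -> R)
    (B : T -> 'M[R]_n.+1) (F : T -> 'rV[R]_n.+1 -> R) :
  (forall t x, U x -> U (x *m B t)) -> (forall t, smooth_on U (F t)) ->
  smooth_on U (rotated_sum c B F).
Proof.
move=> UB sF.
apply: (smooth_on_coind oU (C := fun G => exists (T : finType) (c : T -> R)
  (B : T -> 'M[R]_n.+1) (F : T -> 'rV[R]_n.+1 -> R),
  [/\ forall t x, U x -> U (x *m B t), forall t, smooth_on U (F t) &
      G = rotated_sum c B F]));
  last by exists T, c, B, F.
- move=> _ [{}T [{}c [{}B [{}F [{}UB {}sF ->]]]]] x Ux; split.
    apply: continuous_at_sum => t.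
    have cF : {for x, continuous (F t \o (fun y => y *m B t))}.
      apply: continuous_comp; first exact: mulmx_continuous.
      by apply: smooth_on_continuous (sF t) _; exact: UB.
    exact: (@cvgMl_tmp _ _ (nbhs x) _ _ (c t) _ cF).
  by move=> i; have [] := is_derive_rotated_sum c (delta_mx 0 i) UB sF Ux.
- move=> _ i [{}T [{}c [{}B [{}F [{}UB {}sF ->]]]]].
  exists (rotated_sum (fun p : T * 'I_n.+1 => c p.1 * B p.1 i p.2)
    (fun p => B p.1) (fun p => partial p.2 (F p.1))).
    do 4 eexists; split; last reflexivity; first by move=> t; exact: UB.
    by move=> t; exact: smooth_on_partial.
  by move=> x Ux; exact: partial_rotated_sum.
Qed.

(** Applying the chain rule twice produces the coefficients
    [\sum_i B i j * B i k], which are those of the identity matrix because [B]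
    is orthogonal. *)
Lemma euclid_laplacian_rotated_sum {T : finType} (c : T -> R)
    (B : T -> 'M[R]_n.+1) (F : T -> 'rV[R]_n.+1 -> R) x :
  (forall t, B t *m (B t)^T = 1%:M) ->
  (forall t x, U x -> U (x *m B t)) -> (forall t, smooth_on U (F t)) -> U x ->
  euclid_laplacian (rotated_sum c B F) x =
  rotated_sum c B (fun t => euclid_laplacian (F t)) x.
Proof.
move=> oB UB sF Ux; rewrite /euclid_laplacian.
under eq_bigr => i _.
  rewrite (eq_on_partial oU i (fun y => @partial_rotated_sum T c B F y i UB sF) Ux).
  rewrite partial_rotated_sum //;
    [|by move=> p; exact: UB|by move=> p; exact: smooth_on_partial].
  rewrite /rotated_sum -(pair_bigA _ (fun (p : T * 'I_n.+1) k =>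
    c p.1 * B p.1 i p.2 * B p.1 i k * partial k (partial p.2 (F p.1)) (x *m B p.1))) /=.
  rewrite -(pair_bigA _ (fun t j => \sum_k
    c t * B t i j * B t i k * partial k (partial j (F t)) (x *m B t))) /=.
  over.
rewrite exchange_big; apply: eq_bigr => t _ /=.
rewrite exchange_big mulr_sumr; apply: eq_bigr => j _ /=.
rewrite exchange_big /=.
have oBj k : \sum_i B t i j * B t i k = (j == k)%:R.
  have /matrixP/(_ j k) := mulmx1C (oB t).
  by rewrite !mxE => <-; apply: eq_bigr => i _; rewrite mxE.
rewrite (bigD1 j) //= [X in _ + X]big1 ?addr0 => [|k kj].
  under eq_bigr do rewrite -!mulrA [in X in _ * X]mulrA.
  by rewrite -mulr_sumr -mulr_suml oBj eqxx mul1r.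
under eq_bigr do rewrite -!mulrA [in X in _ * X]mulrA.
by rewrite -mulr_sumr -mulr_suml oBj eq_sym (negbTE kj) mul0r mulr0.
Qed.

End rotated.

(** * The Euclidean norm and the radial projection *)

Section enorm.
Context {R : realType} {n : nat}.
Implicit Types (x y v : 'rV[R]_n.+1).

Lemma sqr_enorm x : enorm x ^+ 2 = \sum_i x 0 i ^+ 2.
Proof. by rewrite sqr_sqrtr // sumr_ge0 // => i _; exact: sqr_ge0. Qed.

Lemma enorm_dot x : x *m x^T = (enorm x ^+ 2)%:M.
Proof.
rewrite [LHS]mx11_scalar sqr_enorm; congr (_%:M).
by rewrite !mxE; apply: eq_bigr => i _; rewrite mxE expr2.
Qed.

Lemma enorm_ge0 x : 0 <= enorm x.
Proof. exact: sqrtr_ge0. Qed.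

Lemma enorm_eq0 x : (enorm x == 0) = (x == 0).
Proof.
apply/idP/eqP => [|->]; last first.
  by rewrite /enorm big1 ?sqrtr0 // => i _; rewrite mxE expr0n.
rewrite -sqrf_eq0 sqr_enorm psumr_eq0; last by move=> i _; exact: sqr_ge0.
move=> /allP x0; apply/rowP => i; apply/eqP.
by have := x0 i (mem_index_enum _); rewrite mxE sqrf_eq0.
Qed.

Lemma enorm_gt0 x : (0 < enorm x) = (x != 0).
Proof. by rewrite lt_def enorm_eq0 enorm_ge0 andbT. Qed.

Lemma enormZ (a : R) x : 0 <= a -> enorm (a *: x) = a * enorm x.
Proof.
move=> a0; rewrite /enorm -{2}[a]ger0_norm // -sqrtr_sqr -sqrtrM ?sqr_ge0 //.
by rewrite mulr_sumr; congr Num.sqrt; apply: eq_bigr => i _; rewrite mxE exprMn.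
Qed.

Lemma enorm_mulmx x (B : 'M[R]_n.+1) : B *m B^T = 1%:M ->
  enorm (x *m B) = enorm x.
Proof.
move=> oB; apply/eqP; rewrite -(@eqrXn2 _ 2) ?enorm_ge0 //; apply/eqP.
have := enorm_dot (x *m B).
rewrite trmx_mul mulmxA -[_ *m B *m _]mulmxA oB mulmx1 enorm_dot.
by move=> /matrixP/(_ 0 0); rewrite !mxE !mulr1n.
Qed.

Lemma is_derive_enorm x v : x != 0 ->
  is_derive x v (@enorm R n.+1) ((\sum_i x 0 i * v 0 i) / enorm x).
Proof.
move=> x0; apply: is_derive_of_line.
pose N t := \sum_i (t *: v + x) 0 i ^+ 2.
have dN : is_derive (0 : R) (1 : R) N (2 * \sum_i x 0 i * v 0 i).
  rewrite mulr_sumr; apply: is_derive_big => i.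
  have -> : (fun t : R => (t *: v + x) 0 i ^+ 2) =
      (fun t => (t * v 0 i + x 0 i) ^+ 2).
    by apply/funext => t; rewrite !mxE.
  apply: is_derive_eq.
  by rewrite /= /GRing.scale /=; ring.
have N0 : N 0 = enorm x ^+ 2 by rewrite /N scale0r add0r sqr_enorm.
have dS : is_derive (N 0) 1 Num.sqrt (2 * Num.sqrt (N 0))^-1.
  by apply: is_derive1_sqrt; rewrite N0 exprn_gt0 // enorm_gt0.
have := is_derive1_comp dS dN.
rewrite N0 sqrtr_sqr ger0_norm ?enorm_ge0 // => h; apply: is_derive_eq.
by field; rewrite enorm_eq0.
Qed.

Lemma open_neq0 : open [set x : 'rV[R]_n.+1 | x != 0].
Proof.
have -> : [set x : 'rV[R]_n.+1 | x != 0] = ~` [set 0].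
  by apply/seteqP; split => x /= /eqP.
apply: closed_openC; apply: accessible_closed_set1.
exact/hausdorff_accessible/norm_hausdorff.
Qed.

Lemma radial_proj_sphere x : x != 0 -> sphere (radial_proj x).
Proof.
move=> x0; rewrite /sphere /= /radial_proj enormZ ?invr_ge0 ?enorm_ge0 //.
by rewrite mulVf // enorm_eq0.
Qed.

Lemma sphere_neq0 x : sphere x -> x != 0.
Proof. by rewrite /sphere /= -enorm_gt0 => ->. Qed.

Lemma radial_projZ (a : R) x : 0 < a -> radial_proj (a *: x) = radial_proj x.
Proof.
move=> a0; rewrite /radial_proj enormZ ?ltW // scalerA invfM.
rewrite -mulrA [_ * a]mulrC mulrA mulVf ?mul1r //.
by rewrite gt_eqF.
Qed.

Lemma radial_proj_mulmx x (B : 'M[R]_n.+1) : B *m B^T = 1%:M ->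
  radial_proj (x *m B) = radial_proj x *m B.
Proof. by move=> oB; rewrite /radial_proj enorm_mulmx // scalemxAl. Qed.

Lemma neq0_mulmx x (B : 'M[R]_n.+1) : B *m B^T = 1%:M -> x != 0 -> x *m B != 0.
Proof. by move=> oB; rewrite -!enorm_gt0 enorm_mulmx. Qed.

End enorm.

(** * The Laplace-Beltrami operator and rotations *)

Section laplace.
Context {R : realType} {n : nat}.
Implicit Types (f : 'rV[R]_n.+1 -> R) (x y v : 'rV[R]_n.+1).

(** The sum is the derivative along [x] itself of a function which is constant
    on the rays from the origin. *)
Lemma derive_radial f x : smooth_on_sphere f -> x != 0 ->
  \sum_i x 0 i * partial i (f \o @radial_proj R n) x = 0.
Proof.
move=> sf x0; have [_ <-] := smooth_on_is_derive open_neq0 x sf x0.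
apply: derive_val; apply: is_derive_of_line.
apply: (@near_eq_is_derive _ _ _ (cst (f (radial_proj x)))).
near=> t; rewrite /cst /= -[X in _ *: _ + X]scale1r -scalerDl radial_projZ //.
(* The ray is only positively scaled as long as [0 < t + 1]. *)
have : `|t| < 1 by near: t; exact: (nbhs0_lt (V := R) ltr01).
by rewrite ltr_norml => /andP[? _]; rewrite -ltrBlDr sub0r.
Unshelve. all: by end_near. Qed.

(** The extension of [f] is homogeneous of degree 0, so its partial derivatives
    are homogeneous of degree -1. *)
Lemma partial_radial_proj f i x : smooth_on_sphere f -> x != 0 ->
  partial i (f \o @radial_proj R n) (radial_proj x) =
  enorm x * partial i (f \o @radial_proj R n) x.
Proof.
move=> sf x0; set F := f \o _.
have e0 : 0 < (enorm x)^-1 by rewrite invr_gt0 enorm_gt0.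
have dF : is_derive (x *m (enorm x)^-1%:M) (delta_mx 0 i *m (enorm x)^-1%:M) F
    ((enorm x)^-1 * partial i F (radial_proj x)).
  rewrite !mul_mx_scalar; apply: is_derive_scale_dir; apply: derivableP.
  apply: smooth_on_derivable sf _; exact/sphere_neq0/radial_proj_sphere.
have := is_derive_mulmx dF.
have -> : (fun y => F (y *m (enorm x)^-1%:M)) = F.
  by apply/funext => y; rewrite /F mul_mx_scalar /= radial_projZ.
move=> [_ E]; rewrite /partial E mulrA divff ?mul1r //.
by rewrite enorm_eq0.
Qed.

(** The divergence differentiates the radially constant extension of each
    component of the gradient, which by [partial_radial_proj] is [enorm] times a
    partial derivative.  The product rule yields the Euclidean Laplacian and a
    term which is the radial derivative of [f], hence zero. *)
Lemma laplace_beltramiE f x : smooth_on_sphere f -> sphere x ->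
  laplace_beltrami f x = - euclid_laplacian (f \o @radial_proj R n) x.
Proof.
move=> sf sx; have x0 := sphere_neq0 sx; set F := f \o _.
have dE i : partial i (fun y => sphere_grad f (radial_proj y) 0 i) x =
    x 0 i * partial i F x + partial i (partial i F) x.
  transitivity (partial i (@enorm R n.+1 * partial i F) x).
    apply: (eq_on_partial open_neq0 _ _ x0) => y y0.
    by rewrite mxE partial_radial_proj.
  have [dN DN] := is_derive_enorm (delta_mx 0 i) x0.
  rewrite /partial deriveM //; last first.
    exact: smooth_on_derivable (smooth_on_partial i sf) x0.
  rewrite DN sx divr1 [_ *: _]mul1r addrC; congr (_ + _).
  rewrite [_ *: _]mulrC; congr (_ * _).
  rewrite (bigD1 i) //= mxE !eqxx mulr1 big1 ?addr0 // => j ji.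
  by rewrite mxE (negbTE ji) andbF mulr0.
rewrite /laplace_beltrami /sphere_div; congr (- _).
under eq_bigr do rewrite dE.
by rewrite big_split /= derive_radial // add0r.
Qed.

Lemma laplace_beltrami_sum_rotations (T : finType) (B : T -> 'M[R]_n.+1) f
    (lambda : R) :
  (forall t, B t *m (B t)^T = 1%:M) -> smooth_on_sphere f ->
  (forall x, sphere x -> laplace_beltrami f x = lambda * f x) ->
  let g := fun x => \sum_t f (x *m B t) in
  smooth_on_sphere g /\
  (forall x, sphere x -> laplace_beltrami g x = lambda * g x).
Proof.
move=> oB sf fl g.
have UB t x : x != 0 -> x *m B t != 0 by exact: neq0_mulmx.
have gE : g \o @radial_proj R n =
    rotated_sum (fun=> 1) B (fun=> f \o @radial_proj R n).
  apply/funext => x; apply: eq_bigr => t _.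
  by rewrite /= mul1r radial_proj_mulmx.
have sg : smooth_on_sphere g.
  by rewrite /smooth_on_sphere gE;
    apply: smooth_on_rotated_sum => //; exact: open_neq0.
split=> // x sx; rewrite laplace_beltramiE // gE.
rewrite (euclid_laplacian_rotated_sum open_neq0 _ oB UB (fun=> sf)
  (sphere_neq0 sx)).
rewrite /rotated_sum -sumrN mulr_sumr; apply: eq_bigr => t _.
have sxB : sphere (x *m B t) by rewrite /sphere /= enorm_mulmx.
by rewrite mul1r -laplace_beltramiE // fl.
Qed.

End laplace.

(** * Orbifolds whose group fixes a point *)

Section orthogonal.
Context {R : realType} {n : nat}.

(** For distinct [x] and [y], the reflection in the hyperplane orthogonal to
    [x - y] exchanges them. *)
Lemma orthogonal_transitive (x y : 'rV[R]_n.+1) : sphere x -> sphere y ->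
  exists2 B : 'M[R]_n.+1, B *m B^T = 1%:M & x *m B = y.
Proof.
move=> sx sy; have [->|xy] := eqVneq x y.
  by exists 1%:M; rewrite ?trmx1 ?mulmx1.
pose w := x - y; pose c := enorm w ^+ 2.
have c0 : c != 0 by rewrite expf_eq0 /= enorm_eq0 subr_eq0.
have ww : w *m w^T = c%:M := enorm_dot w.
have xx : x *m x^T = 1%:M by rewrite enorm_dot sx expr1n.
have yy : y *m y^T = 1%:M by rewrite enorm_dot sy expr1n.
have xw : x *m w^T = (c / 2)%:M.
  have : w *m w^T = x *m w^T + x *m w^T.
    rewrite {1}/w mulmxBl /w linearB /= !mulmxBr xx yy.
    have -> : y *m x^T = x *m y^T.
      by rewrite [LHS]mx11_scalar -tr_scalar_mx -mx11_scalar trmx_mul trmxK.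
    by rewrite opprB addrA.
  rewrite ww => /matrixP/(_ 0 0); rewrite [RHS]mxE [LHS]mxE mulr1n => E.
  rewrite [LHS]mx11_scalar; congr (_%:M); lra.
pose W := w^T *m w.
have trW : W^T = W by rewrite /W trmx_mul trmxK.
have WW : W *m W = c *: W.
  by rewrite /W -mulmxA [w *m (_ *m _)]mulmxA ww mul_scalar_mx -scalemxAr.
exists (1%:M - (2 / c) *: W).
  have -> : (1%:M - (2 / c) *: W)^T = 1%:M - (2 / c) *: W.
    by rewrite [LHS]linearB /= [in LHS]linearZ /= trW trmx1.
  rewrite mulmxBl mul1mx mulmxBr mulmx1.
  rewrite -scalemxAl -scalemxAr WW.
  have -> : (2 / c) *: ((2 / c) *: (c *: W)) = (2 / c) *: W + (2 / c) *: W.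
    by rewrite !scalerA -scalerDl; congr (_ *: _); field.
  by rewrite opprB addrK subrK.
rewrite /W mulmxBr mulmx1 -scalemxAr mulmxA xw mul_scalar_mx scalerA.
by rewrite mulrA divfK // divff ?pnatr_eq0 // scale1r /w opprB addrC subrK.
Qed.

End orthogonal.

Section spectrum.
Context {R : realType} {n : nat}.

(** Averaging an eigenfunction over a group can give zero, but not when the
    eigenfunction is nonzero at a fixed point of the group; rotating it first
    achieves that. *)
Lemma is_eigenvalue_fixed_point (M M' : spherical_orbifold R n)
    (p : 'rV[R]_n.+1) (lambda : R) :
  sphere p -> (forall A, A \in orbifold_group M' -> p *m A = p) ->
  is_eigenvalue M lambda -> is_eigenvalue M' lambda.
Proof.
move=> sp pG [f [sf _ [x0 sx0 fx0] fl]].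
have [oG G1 GM GV] := orbifold_groupP M'.
set G := orbifold_group M' in oG G1 GM GV pG.
have [B oB pB] := orthogonal_transitive sp sx0.
pose C (A : G) := val A *m B.
have oC (A : G) : C A *m (C A)^T = 1%:M.
  by rewrite /C trmx_mul mulmxA -[_ *m B *m _]mulmxA oB mulmx1 oG // (valP A).
have [sg gl] := laplace_beltrami_sum_rotations oC sf fl.
exists (fun x => \sum_A f (x *m C A)); split=> //.
- move=> A0 x A0G _.
  (* Left translation by [A0] permutes the terms of the average. *)
  pose h (A : G) : G := [` GM _ _ A0G (valP A) ]%fset.
  have hI : injective h.
    move=> A A' /(congr1 val) /= /(congr1 (mulmx A0^T)).
    by rewrite !mulmxA (mulmx1C (oG _ A0G)) !mul1mx => /val_inj.
  rewrite [RHS](reindex_inj hI) /=.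
  by apply: eq_bigr => A _; rewrite /C !mulmxA.
- exists p => //.
  have -> : \sum_A f (p *m C A) = \sum_(A : G) f x0.
    by apply: eq_bigr => A _; rewrite /C mulmxA pG ?(valP A) // pB.
  rewrite sumr_const -mulr_natl mulf_neq0 // pnatr_eq0.
  by rewrite -lt0n; apply/card_gt0P; exists [` G1]%fset.
Qed.

End spectrum.

(** * Orbifolds of permutation groups *)

Section permutations.
Context (R : realType) (n : nat).
Implicit Types (H K : {group 'S_n.+1}).

Definition perm_mxs H : {fset 'M[R]_n.+1} := [fset perm_mx s | s in H]%fset.

Lemma perm_mxsP H : orthogonal_group (perm_mxs H).
Proof.
split.
- by move=> _ /imfsetP[s _ ->]; rewrite tr_perm_mx -perm_mxM mulgV perm_mx1.
- by apply/imfsetP; exists 1%g; rewrite ?group1 ?perm_mx1.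
- move=> _ _ /imfsetP[s sH ->] /imfsetP[t tH ->].
  by apply/imfsetP; exists (s * t)%g; rewrite ?perm_mxM //; exact: groupM.
- move=> _ /imfsetP[s sH ->]; apply/imfsetP; exists s^-1%g; first exact: groupVr.
  by rewrite perm_mxV.
Qed.

Definition perm_orbifold H := SphericalOrbifold (perm_mxsP H).

Lemma perm_mx_inj : injective (@perm_mx R n.+1).
Proof.
move=> s t st; apply/permP => i.
have /matrixP/(_ i (s i)) := st; rewrite !mxE eqxx.
by case: eqP => // _ /eqP; rewrite oner_eq0.
Qed.

Lemma card_perm_mxs H : #|` perm_mxs H| = #|H|.
Proof.
rewrite card_imfset; last exact: perm_mx_inj.
by rewrite cardE.
Qed.

Lemma sphere_delta (i : 'I_n.+1) : sphere (delta_mx 0 i : 'rV[R]_n.+1).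
Proof.
rewrite /sphere /= /enorm (bigD1 i) //= mxE !eqxx expr1n big1 ?addr0 ?sqrtr1 //.
by move=> j ji; rewrite mxE (negbTE ji) andbF expr0n.
Qed.

Lemma delta_perm_mx (i : 'I_n.+1) (s : 'S_n.+1) : s i = i ->
  delta_mx 0 i *m perm_mx s = delta_mx 0 i :> 'rV[R]_n.+1.
Proof. by move=> si; apply/rowP => j; rewrite -rowE !mxE si eqxx eq_sym. Qed.

Lemma perm_orbifold_eigenvalue_equivalent H K (i : 'I_n.+1) :
  (forall s, s \in H -> s i = i) -> (forall s, s \in K -> s i = i) ->
  eigenvalue_equivalent (perm_orbifold H) (perm_orbifold K).
Proof.
move=> Hi Ki; apply/seteqP; split => lambda /=;
  apply: (is_eigenvalue_fixed_point (sphere_delta i)) => _ /imfsetP[s sH ->].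
- exact/delta_perm_mx/Ki.
- exact/delta_perm_mx/Hi.
Qed.

End permutations.

Lemma three_cycle_order (T : finType) (a b c : T) : uniq [:: a; b; c] ->
  #[tperm a b * tperm b c]%g = 3.
Proof.
rewrite /= !inE negb_or -andbA => /and4P[ab ac bc _].
have ba : b != a by rewrite eq_sym.
have ca : c != a by rewrite eq_sym.
set s := (_ * _)%g.
have sa : s a = c by rewrite permM tpermL tpermL.
have sb : s b = a by rewrite permM tpermR tpermD.
have sc : s c = b by rewrite permM [tperm a b c]tpermD ?tpermR.
have sx x : x != a -> x != b -> x != c -> s x = x.
  by move=> xa xb xc; rewrite permM [tperm a b x]tpermD 1?eq_sym // tpermD //
    eq_sym.
clearbody s.
have s_neq1 : s != 1%g by apply: contra_neq ca => s1; rewrite -sa s1 perm1.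
apply: nt_prime_order s_neq1 => //.
apply/permP => x; rewrite perm1 !expgS expg0 mulg1 !permM.
have [->|xa] := eqVneq x a; first by rewrite sa sc sb.
have [->|xb] := eqVneq x b; first by rewrite sb sa sc.
have [->|xc] := eqVneq x c; first by rewrite sc sb sa.
by rewrite !sx.
Qed.

Theorem theorem1p2 (R : realType) (n : nat) (hn : (9 <= n)%N) :
  exists M1 M2 : spherical_orbifold R n,
    eigenvalue_equivalent M1 M2 /\
    orbifold_volume M2 = 3 * orbifold_volume M1.
Proof.
(* [d] is a coordinate outside of the 3-cycle, giving the fixed point. *)
pose a : 'I_n.+1 := inord 0; pose b : 'I_n.+1 := inord 1.
pose c : 'I_n.+1 := inord 2; pose d : 'I_n.+1 := inord 3.
have abcd : uniq [:: a; b; c; d].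
  rewrite -(map_inj_uniq val_inj) /= !inordK //; exact: leq_trans (leqW hn).
pose s := (tperm a b * tperm b c)%g.
exists (perm_orbifold R <[s]>), (perm_orbifold R 1); split.
  apply: (@perm_orbifold_eigenvalue_equivalent _ _ _ _ d); last first.
    by move=> t /set1P ->; rewrite perm1.
  suff sd : s d = d.
    move=> _ /cycleP[k ->]; elim: k => [|k IH]; first by rewrite expg0 perm1.
    by rewrite expgS permM sd.
  move: abcd; rewrite /= !inE !negb_or => /and4P[/and3P[_ _ ad] /andP[_ bd] cd _].
  by rewrite permM [tperm a b d]tpermD // tpermD.
have s3 : #|<[s]>%g| = 3%N.
  rewrite -orderE; apply: three_cycle_order.
  by apply: subseq_uniq abcd; exact: (prefix_subseq [:: a; b; c] [:: d]).
rewrite /orbifold_volume /perm_orbifold !card_perm_mxs cards1 s3 divr1.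
by rewrite mulrC divfK // pnatr_eq0.
Qed.
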